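(* Fix a base $B>1$ and $L>0$. Let $X_1,\dots,X_N$ be independent random variables, each drawn from the uniform distribution on $[0,L]$, and let $X_{1:N}\le X_{2:N}\le\cdots\le X_{N:N}$ be the $X_i$'s in increasing order. Then, as $N\to\infty$ (with $L$ fixed), the distribution of the digits (base $B$) of the differences $X_{i+1:N}-X_{i:N}$ converges to shifted exponential behavior, with a shift of $\log_B(L/N)\bmod 1$.
   Context: The data are continued periodically by setting $X_{i+N:N}=X_{i:N}+L$, so that there are $N$ differences $X_{i+1:N}-X_{i:N}$, $1\le i\le N$. Every positive real $x$ is written uniquely as $x=M_B(x)B^k$ with $k\in\mathbb{Z}$ and mantissa $M_B(x)\in[1,B)$; the distribution of the digits base $B$ of positive quantities is the distribution of their mantissas, equivalently of their base $B$ logarithms modulo $1$. Let $\zeta$ have the standard exponential distribution (density $e^{-t}$ on $[0,\infty)$). A set exhibits exponential behavior (base $B$) if the distribution of its digits is the same as the distribution of the digits of $\zeta$. It exhibits shifted exponential behavior if there is a constant $C>0$ such that the distribution of digits of all its elements multiplied by $C$ is exponential behavior; its base $B$ logarithms modulo $1$ are then distributed as a translate modulo $1$ of $\log_B\zeta\bmod 1$. In the claim, the shift $\log_B(L/N)\bmod 1$ is the amount of this translation: the logarithms of the differences behave like $\log_B\zeta+\log_B(L/N)$ modulo $1$. *)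

(* Defs.v *)
From HB Require Import structures.
From mathcomp Require Import all_boot all_order all_algebra.
From mathcomp Require Import all_classical all_reals all_analysis.
Import Order.TTheory GRing.Theory Num.Theory.
Import numFieldNormedType.Exports.

Set Implicit Arguments.
Unset Strict Implicit.
Unset Printing Implicit Defensive.

Local Open Scope classical_set_scope.
Local Open Scope ring_scope.

Definition mod1 {R : realType} (x : R) : R := x - (Num.floor x)%:~R.

Definition logB {R : realType} (B x : R) : R := ln x / ln B.

(* Digits of x are recorded by log_B x mod 1; by mantissaP below the mantissa
   M_B(x) is B `^ digit_log B x.  As ln is 0 on nonpositive reals,
   digit_log B x = 0 for x <= 0. *)
Definition digit_log {R : realType} (B x : R) : R := mod1 (logB B x).

Lemma mod1_itv (R : realType) (x : R) : 0 <= mod1 x < 1.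
Proof. by rewrite /mod1 subr_ge0 floor_le ltrBlDl -intrD1 floorD1_gt. Qed.

Lemma mantissaP (R : realType) (B x : R) : 1 < B -> 0 < x ->
  1 <= B `^ digit_log B x < B /\
  x = B `^ digit_log B x * B ^ Num.floor (logB B x).
Proof.
move=> B1 x0; have B0 : 0 < B by apply: lt_trans B1.
have lnB0 : 0 < ln B by rewrite ln_gt0.
have /andP[m0 m1] := mod1_itv (logB B x).
split.
  apply/andP; split.
    by rewrite -[leLHS](powRr0 B) ler_powR// ltW.
  by rewrite -[ltRHS](lnK B0) /powR gt_eqF// ltr_expR gtr_pMl.
rewrite -powR_intmul ?(ltW B0)// -powRD; last first.
  by rewrite (gt_eqF B0) implybT.
rewrite /digit_log /mod1 subrK.
by rewrite /powR gt_eqF// /logB divfK ?gt_eqF// lnK.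
Qed.

(* Indices are 0-based: order_stat x k is the (k+1)-st smallest of the x i for
   k < N, extended to all k by order_stat x (k + N) = order_stat x k + L. *)
Definition order_stat {R : realType} (L : R) (N : nat) (x : 'I_N -> R)
    (k : nat) : R :=
  nth 0 (sort <=%R (codom x)) (k %% N) + (k %/ N)%:R * L.

Definition spacing {R : realType} (L : R) (N : nat) (x : 'I_N -> R)
    (i : 'I_N) : R :=
  order_stat L x i.+1 - order_stat L x i.

Definition digit_cdf {R : realType} (B : R) (N : nat) (y : 'I_N -> R)
    (u : R) : R :=
  #|[set i : 'I_N | digit_log B (y i) <= u]%SET|%:R / N%:R.

(* For zeta standard exponential, the distribution function on [0, 1[ of the
   translate mod 1 by a of log_B zeta mod 1. *)
Definition shifted_exp_digit_cdf {R : realType} (B a u : R) : R :=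
  fine (exponential_prob 1 [set t : R | mod1 (digit_log B t + a) <= u]).

Definition kolmogorov_dist01 {R : realType} (F G : R -> R) : R :=
  sup [set `|F u - G u| | u in `[0, 1[].

Definition mutually_independent {d} {T : measurableType d} {R : realType}
    (P : probability T R) (I : finType) (X : I -> {RV P >-> R}) : Prop :=
  forall (J : {set I}) (A : I -> set R), (forall i, measurable (A i)) ->
    P (\bigcap_(i in [set` J]) (X i @^-1` A i)) =
    (\prod_(i in J) P (X i @^-1` A i))%E.

Definition uniformly_distributed {d} {T : measurableType d} {R : realType}
    (P : probability T R) (a b : R) (ab : a < b) (X : {RV P >-> R}) : Prop :=
  forall A : set R, measurable A -> distribution P X A = uniform_prob ab A.

(* Main.v *)
Require Import Defs.
From mathcomp Require Import all_boot all_order all_algebra.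
From mathcomp Require Import all_classical all_reals all_analysis.
From mathcomp Require Import measurable_realfun zify ring lra.
Import Order.TTheory GRing.Theory Num.Theory.
Import numFieldNormedType.Exports.
Local Open Scope classical_set_scope.
Local Open Scope ring_scope.
Set Implicit Arguments.
Unset Strict Implicit.

(* Cut [0, L] into M = N m cells of length L / M, with m fixed.  The number W_r
   of cells followed (cyclically) by r empty cells is the sum over the N gaps of
   (d - r)^+, d being the gap measured in cells, so W_r - W_(r+1) counts the gaps
   with d > r.  The first two moments of W_r are elementary counts over the M^N
   equally likely cell assignments: disjoint arcs are negatively correlated, and
   only a fraction O(1/M) of the pairs of arcs meet.  Hence W_r / M is close to
   (1 - r/M)^N, i.e. to exp(-r/m), with probability 1 - O(1/N), and the empirical
   tails of the gaps divided by L/N are uniformly close to exp(-x) on compact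
   sets.  Away from 0 and infinity, a set of numbers whose digits lie below a
   given bound is a union of boundedly many intervals, so closeness of the tails
   yields closeness of the digit distributions, uniformly in the bound. *)

(** * Counting empty arcs of cells *)

(** An arc on a circle of [M] cells. [j] is a natural number rather than an ordinal, so that it can
    run along the unrolled line. *)
Definition cells_after (M j r : nat) : {set 'I_M} :=
  [set c : 'I_M | [exists l : 'I_r, (c == (j.+1 + l) %% M :> nat)%N]]%SET.

Definition avoids (N M : nat) (S : {set 'I_M}) (f : {ffun 'I_N -> 'I_M}) :=
  [forall i, f i \notin S].

(* The W_r of the header. *)
Definition empty_arcs (N M r : nat) (f : {ffun 'I_N -> 'I_M}) : nat :=
  (\sum_(j < M) avoids (cells_after M j r) f)%N.

Lemma cells_afterP (M j r : nat) (c : 'I_M) :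
  reflect (exists2 l, (l < r)%N & c = (j.+1 + l) %% M :> nat)%N (c \in cells_after M j r).
Proof.
rewrite inE; apply: (iffP existsP) => [[l /eqP e]|[l lr e]].
  by exists l.
by exists (Ordinal lr); apply/eqP.
Qed.

Lemma card_cells_after (M j r : nat) : (r <= M)%N -> #|cells_after M j r| = r.
Proof.
move=> rM; have [M0|M0] := posnP M.
  by move: rM; rewrite M0 leqn0 => /eqP ->; apply: eq_card0 => -[].
have h (l : 'I_r) : ((j.+1 + l) %% M < M)%N by rewrite ltn_mod.
have -> : cells_after M j r = [set Ordinal (h l) | l in 'I_r]%SET.
  apply/setP => c; apply/cells_afterP/imsetP.
    by case=> l lr e; exists (Ordinal lr) => //; apply: val_inj.
  by case=> l _ ->; exists l.
rewrite card_imset ?card_ord// => l l' /(congr1 val)/= /eqP.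
rewrite eqn_modDl !modn_small; last 2 first.
- exact: leq_trans (ltn_ord _) rM.
- exact: leq_trans (ltn_ord _) rM.
by move=> /eqP /val_inj.
Qed.

(** Each of the [N] points picks its cell freely outside [S]. *)
Lemma sum_avoids (N M : nat) (S : {set 'I_M}) :
  (\sum_(f : {ffun 'I_N -> 'I_M}) avoids S f = (M - #|S|) ^ N)%N.
Proof.
transitivity (#|ffun_on (mem (~: S)) : {pred {ffun 'I_N -> 'I_M}}|).
  rewrite -big_mkcond sum1_card; apply: eq_card => f.
  rewrite !inE; apply/forallP/ffun_onP => /= H i; move: (H i); rewrite inE//.
by rewrite card_ffun_on card_ord [X in (X ^ _)%N](cardsCs (~: S)) finset.setCK card_ord.
Qed.

(** Makes a product of two indicators an indicator again, so that [sum_avoids] also serves for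
    second moments. *)
Lemma avoidsM (N M : nat) (S S' : {set 'I_M}) (f : {ffun 'I_N -> 'I_M}) :
  (avoids S f * avoids S' f = avoids (S :|: S') f)%N.
Proof.
rewrite mulnb; congr (nat_of_bool _); apply/andP/forallP.
  by case=> /forallP a /forallP b i; rewrite inE negb_or a b.
by move=> H; split; apply/forallP => i; move: (H i); rewrite inE negb_or => /andP[].
Qed.

Lemma sum_empty_arcs (N M r : nat) : (r <= M)%N ->
  (\sum_(f : {ffun 'I_N -> 'I_M}) empty_arcs r f = M * (M - r) ^ N)%N.
Proof.
move=> rM; rewrite exchange_big/=.
under eq_bigr do rewrite sum_avoids card_cells_after//.
by rewrite sum_nat_const card_ord.
Qed.

(** A common cell at offset [l] from [j] and [l'] from [j'] determines [j'] as [j + l - l'] modulo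
    [M], and there are [r ^ 2] pairs of offsets. *)
Lemma card_meeting_arcs (M r : nat) (j : 'I_M) :
  (\sum_(j' < M) ~~ [disjoint cells_after M j r & cells_after M j' r] <= r ^ 2)%N.
Proof.
have M0 : (0 < M)%N by apply: leq_trans (ltn_ord j).
(* [M - l.2 %% M] stands for [- l.2] modulo [M], without truncation. *)
have h (l : 'I_r * 'I_r) : ((j + l.1 + (M - l.2 %% M)) %% M < M)%N.
  by rewrite ltn_mod.
rewrite -big_mkcond sum1_card.
apply: leq_trans (_ : #|[set Ordinal (h l) | l : 'I_r * 'I_r]%SET| <= _)%N; last first.
  by rewrite (leq_trans (leq_imset_card _ _))// card_prod card_ord.
apply/subset_leq_card/fintype.subsetP => j' /pred0Pn[c] /andP[/cells_afterP[l lr e] /cells_afterP[l' lr' e']].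
apply/imsetP; exists (Ordinal lr, Ordinal lr') => //; apply: val_inj => /=.
rewrite -[LHS](modn_small (ltn_ord j')); apply/eqP.
rewrite -(eqn_modDr (1 + l')).
have -> : (j' + (1 + l') = j'.+1 + l')%N by lia.
rewrite -e' e.
have -> : (j + l + (M - l' %% M) + (1 + l') = j.+1 + l + (M - l' %% M + l'))%N by lia.
have -> : (M - l' %% M + l' = (l' %/ M).+1 * M)%N.
  rewrite {2}(divn_eq l' M) mulSn; have := ltn_pmod l' M0.
  by move: (l' %% M)%N (l' %/ M * M)%N => x y; lia.
by rewrite [X in _ == X %[mod _]]addnC modnMDl.
Qed.

(* Pairs of disjoint arcs contribute (M - 2r)^N; each arc meets at most r^2 others. *)
Lemma sum_empty_arcs_sqr (N M r : nat) : (r <= M)%N ->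
  (\sum_(f : {ffun 'I_N -> 'I_M}) empty_arcs r f ^ 2 <=
     M ^ 2 * (M - r.*2) ^ N + M * r ^ 2 * M ^ N)%N.
Proof.
move=> rM.
have -> : (\sum_(f : {ffun 'I_N -> 'I_M}) empty_arcs r f ^ 2 =
  \sum_(j < M) \sum_(j' < M) (M - #|cells_after M j r :|: cells_after M j' r|) ^ N)%N.
  under eq_bigr => f _.
    rewrite -mulnn /empty_arcs big_distrl/=.
    under eq_bigr => j _ do rewrite big_distrr/=.
    over.
  rewrite exchange_big/=; apply: eq_bigr => j _.
  rewrite exchange_big/=; apply: eq_bigr => j' _.
  by under eq_bigr do rewrite avoidsM; rewrite sum_avoids.
apply: (@leq_trans (\sum_(j < M) (M * (M - r.*2) ^ N + r ^ 2 * M ^ N))%N); last first.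
  by rewrite sum_nat_const card_ord; lia.
apply: leq_sum => j _.
apply: (@leq_trans (\sum_(j' < M) ((M - r.*2) ^ N +
    ~~ [disjoint cells_after M j r & cells_after M j' r] * M ^ N))%N); last first.
  rewrite big_split/= sum_nat_const card_ord leq_add2l -big_distrl/=.
  by rewrite leq_mul2r card_meeting_arcs orbT.
apply: leq_sum => j' _; have [dis|_] := boolP [disjoint _ & _]; last first.
  rewrite /= mul1n (leq_trans _ (leq_addl _ _))//.
  by have [->|N0] := posnP N; rewrite ?expn0// leq_exp2r// leq_subr.
by rewrite cardsU finset.disjoint_setI0// cards0 !card_cells_after// subn0 addnn leq_addr.
Qed.

(** Chebyshev's inequality for the counting measure: the mean of [W_r] is exactly [M * p], and the
    variance is at most [M * r ^ 2], a bound to which only the meeting arcs contribute. *)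
Lemma empty_arcs_chebyshev (R : realFieldType) (N M r : nat) (eta : R) :
  (0 < M)%N -> (r <= M)%N -> 0 < eta ->
  #|[set f : {ffun 'I_N -> 'I_M} |
     eta < `|(empty_arcs r f)%:R / M%:R - ((M - r)%:R / M%:R) ^+ N|]%SET|%:R
    / (M ^ N)%:R <= (r ^ 2)%:R / (M%:R * eta ^+ 2).
Proof.
move=> M0 rM eta0; set p := _ ^+ N; set Q := finset _.
have MR : 0 < M%:R :> R by rewrite ltr0n.
have MNR : 0 < (M ^ N)%:R :> R by rewrite ltr0n expn_gt0 M0.
set W := fun f : {ffun 'I_N -> 'I_M} => (empty_arcs r f)%:R : R.
have cheb : #|Q|%:R * (eta * M%:R) ^+ 2 <= \sum_f (W f - M%:R * p) ^+ 2.
  rewrite -sum1_card natr_sum mulr_suml big_mkcond/=.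
  apply: ler_sum => f _; rewrite inE; case: ifP => [h|_]; last exact: sqr_ge0.
  rewrite mul1r -[leRHS]real_normK ?num_real// ler_pXn2r ?nnegrE// ?mulr_ge0 ?(ltW eta0)//.
  have -> : W f - M%:R * p = (W f / M%:R - p) * M%:R by field; lra.
  by rewrite normrM [`|M%:R|]gtr0_norm// ler_pM2r// ltW.
have EW : \sum_f W f = (M ^ N)%:R * M%:R * p.
  rewrite -natr_sum sum_empty_arcs// natrM /p expr_div_n -!natrX.
  by field; rewrite gt_eqF.
have EW2 : \sum_f W f ^+ 2 <= (M ^ N)%:R * (M%:R ^+ 2 * p ^+ 2 + M%:R * (r ^ 2)%:R).
  rewrite (eq_bigr (fun f => (empty_arcs r f ^ 2)%:R)); last by move=> f _; rewrite natrX.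
  rewrite -natr_sum.
  apply: le_trans (_ : (M ^ 2 * (M - r.*2) ^ N + M * r ^ 2 * M ^ N)%:R <= _).
    by rewrite ler_nat sum_empty_arcs_sqr.
  (* Negative correlation of disjoint arcs: [M * (M - 2 * r) <= (M - r) ^ 2], raised to the power
     [N]. *)
  have key : ((M - r.*2) ^ N)%:R <= (M ^ N)%:R * p ^+ 2.
    rewrite /p -exprM mulnC exprM !natrX -exprMn.
    apply: lerXn2r; rewrite ?nnegrE ?mulr_ge0 ?invr_ge0 ?sqr_ge0//.
    have -> : M%:R * ((M - r)%:R / M%:R) ^+ 2 = (M - r)%:R ^+ 2 / M%:R :> R.
      by field; lra.
    by rewrite ler_pdivlMr// -natrX -natrM ler_nat; nia.
  rewrite natrD mulrDr; apply: lerD; last first.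
    by rewrite natrM mulrC [(M * _)%:R]natrM.
  by rewrite natrM natrX [leRHS]mulrCA ler_pM2l ?exprn_gt0.
have {}cheb : #|Q|%:R * (eta * M%:R) ^+ 2 <= (M ^ N)%:R * M%:R * (r ^ 2)%:R.
  apply: le_trans cheb _.
  have -> : \sum_f (W f - M%:R * p) ^+ 2 =
      \sum_f W f ^+ 2 - 2 * (M%:R * p) * \sum_f W f + (M ^ N)%:R * (M%:R * p) ^+ 2.
    rewrite mulr_sumr -sumrB [(M ^ N)%:R * _]mulr_natl.
    have -> : (M ^ N)%N = #|{ffun 'I_N -> 'I_M}| by rewrite card_ffun !card_ord.
    rewrite -sumr_const -big_split/=.
    by apply: eq_bigr => f _; ring.
  by rewrite EW; lra.
rewrite ler_pdivrMr// mulrAC ler_pdivlMr ?mulr_gt0 ?exprn_gt0//.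
rewrite -(ler_pM2r MR); move: cheb; rewrite exprMn; lra.
Qed.

(** [c] lists the occupied cells in order on the unrolled line, and [g j] says that the [r] cells
    after [j] are empty. A full period is cut at the [c k]; in the block from [c k] to [c k.+1]
    exactly the [j] with [j + r < c k.+1] count, and truncated subtraction yields the positive
    part. *)
Lemma sum_cell_gaps (c : nat -> nat) (N M r : nat) (g : nat -> bool) :
  {homo c : k k' / (k <= k')%N} -> (c N = c 0 + M)%N ->
  (forall j, g (j + M)%N = g j) ->
  (forall j, g j <-> forall k l, (l < r)%N -> c k <> (j.+1 + l)%N) ->
  (\sum_(j < M) g j = \sum_(k < N) (c k.+1 - c k - r))%N.
Proof.
move=> chomo cN gM gP.
(* By periodicity all windows of [M] consecutive indices have the same sum, so the period may start
   at [c 0]. *)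
have shift a : (\sum_(a <= j < a + M) g j = \sum_(j < M) g j)%N.
  elim: a => [|a IH]; first by rewrite add0n big_mkord.
  rewrite -IH; have [->|M0] := posnP M; first by rewrite !addn0 !big_geq.
  rewrite addSn big_nat_recr/=; last by lia.
  rewrite gM addnC -big_ltn//; lia.
rewrite -(shift (c 0)) -cN.
have -> : (\sum_(c 0 <= j < c N) g j = \sum_(k < N) \sum_(c k <= j < c k.+1) g j)%N.
  elim: N {cN} => [|n IH]; first by rewrite big_ord0 big_geq.
  by rewrite big_ord_recr/= -IH -big_cat_nat//= chomo.
apply: eq_bigr => k _.
rewrite (eq_big_nat _ _ (F2 := fun j => (j + r < c k.+1)%N : nat)); last first.
  move=> j /andP[kj jk]; congr nat_of_bool; apply/idP/idP.
    move=> /gP h; rewrite ltnNge; apply/negP => ckr.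
    by apply: (h k.+1 (c k.+1 - j.+1)%N); lia.
  move=> h; apply/gP => k' l lr e; have [kk|kk] := leqP k' k.
    by have := chomo _ _ kk; lia.
  by have := chomo _ _ kk; lia.
have := chomo _ _ (leqnSn k); move: (c k) (c k.+1) => a b ab.
transitivity (\sum_(a <= j < b | (j + r < b)) 1)%N; first by rewrite [RHS]big_mkcond.
have [br|br] := leqP a (b - r).
  rewrite (big_cat_nat (n := b - r))//=; last by rewrite leq_subr.
  rewrite big_nat_cond (eq_bigl (fun j => (a <= j < b - r)%N)); last by move=> j; lia.
  rewrite -big_nat sum_nat_const_nat muln1 big_nat_cond big_pred0; first by lia.
  by move=> j; lia.
rewrite big_nat_cond big_pred0; first by lia.
by move=> j; lia.
Qed.

(** * Order statistics and cells *)

Lemma order_statD (R : realType) (L : R) (N : nat) (x : 'I_N -> R) (k q : nat) :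
  (0 < N)%N -> order_stat L x (k + q * N) = order_stat L x k + q%:R * L.
Proof.
by move=> N0; rewrite /order_stat [(k + _)%N]addnC modnMDl divnMDl// natrD; ring.
Qed.

Lemma order_stat_mem (R : realType) (L : R) (N : nat) (x : 'I_N -> R) (k : nat) :
  (0 < N)%N -> exists i, order_stat L x k = x i + (k %/ N)%:R * L.
Proof.
move=> N0; have : nth 0 (sort <=%R (codom x)) (k %% N) \in codom x.
  by rewrite -(mem_sort <=%R) mem_nth// size_sort size_codom card_ord ltn_mod.
by case/codomP => i e; exists i; rewrite /order_stat e.
Qed.

Lemma order_stat_surj (R : realType) (L : R) (N : nat) (x : 'I_N -> R) (i : 'I_N) :
  exists k, order_stat L x k = x i.
Proof.
have xi : x i \in sort <=%R (codom x) by rewrite mem_sort codom_f.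
exists (index (x i) (sort <=%R (codom x))).
have kN : (index (x i) (sort <=%R (codom x)) < N)%N.
  by rewrite -[ltnRHS]card_ord -(size_codom x) -(size_sort <=%R) index_mem.
by rewrite /order_stat modn_small// divn_small// mul0r addr0 nth_index.
Qed.

(** Inside a period this is sortedness; at a multiple of [N] the index wraps around and the added
    [L] outweighs any drop, all values lying in [[0, L]]. *)
Lemma order_stat_le (R : realType) (L : R) (N : nat) (x : 'I_N -> R) :
  (0 < N)%N -> (forall i, 0 <= x i <= L) ->
  {homo order_stat L x : k l / (k <= l)%N >-> k <= l}.
Proof.
move=> N0 xL; apply: homo_leq => [//|k l n|k]; first exact: le_trans.
have [i ei] := order_stat_mem L x k N0; have [j ej] := order_stat_mem L x k.+1 N0.
have /andP[_ xi] := xL i; have /andP[xj _] := xL j.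
have [e|ne] := eqVneq (k.+1 %% N)%N 0%N.
  have dN : (k.+1 %/ N = (k %/ N).+1)%N by rewrite divnS// /dvdn e eqxx add1n.
  by rewrite ei ej dN -natr1 mulrDl mul1r; lra.
have sN : ((k %% N).+1 < N)%N.
  rewrite ltn_neqAle ltn_mod N0 andbT; apply: contra ne => /eqP e.
  by rewrite -addn1 -modnDml addn1 e modnn.
have dN : (k.+1 %/ N = k %/ N)%N.
  by rewrite divnS// /dvdn (negbTE ne).
have mN : (k.+1 %% N = (k %% N).+1)%N by rewrite -addn1 -modnDml addn1 modn_small.
rewrite /order_stat dN mN lerD2r.
apply: (sorted_leq_nth le_trans le_refl) => //.
- by apply: sort_sorted; exact: le_total.
- by rewrite inE size_sort size_codom card_ord ltnW.
- by rewrite inE size_sort size_codom card_ord.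
Qed.

Section cells.
Variables (R : realType) (L h : R) (N M : nat) (x : 'I_N -> R).
Variable (f : {ffun 'I_N -> 'I_M}).
Hypothesis N0 : (0 < N)%N.
Hypothesis h0 : 0 < h.
Hypothesis Lh : L = M%:R * h.
Hypothesis xf : forall i, (f i)%:R * h <= x i < (f i).+1%:R * h.

Let y := order_stat L x.
(** The cell of the [k]-th order statistic on the unrolled line, not reduced modulo [M]. *)
Let c k := Num.truncn (y k / h).

Let M0 : (0 < M)%N.
Proof. exact: leq_trans (ltn_ord (f (Ordinal N0))). Qed.

Let xL i : 0 <= x i <= L.
Proof.
have /andP[lo up] := xf i; apply/andP; split.
  by apply: le_trans lo; rewrite mulr_ge0// ltW.
by rewrite (le_trans (ltW up))// Lh ler_pM2r// ler_nat.
Qed.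

Let yc k i q : y k = x i + q%:R * L -> c k = (f i + q * M)%N.
Proof.
move=> e; apply: truncn_def; rewrite ler_pdivlMr// ltr_pdivrMr// e Lh.
have /andP[lo up] := xf i.
rewrite -addSn !natrD !natrM; apply/andP; split; lra.
Qed.

Let y_cell k : (c k)%:R * h <= y k < (c k).+1%:R * h.
Proof.
have [i e] := order_stat_mem L x k N0.
rewrite -ler_pdivlMr// -ltr_pdivrMr// truncn_itv// divr_ge0// ?(ltW h0)//.
rewrite /y e addr_ge0//; first by have /andP[] := xL i.
by rewrite mulr_ge0// Lh mulr_ge0// ltW.
Qed.

Let c_homo : {homo c : k l / (k <= l)%N}.
Proof.
move=> k l kl; apply: le_truncn; rewrite ler_pM2r ?invr_gt0//.
exact: order_stat_le.
Qed.

Lemma empty_arcs_gaps r : (empty_arcs r f = \sum_(k < N) (c k.+1 - c k - r))%N.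
Proof.

apply: (sum_cell_gaps (c := c) (g := fun j => avoids (cells_after M j r) f)) => //.
- have [i] := order_stat_mem L x 0 N0; rewrite div0n => e0.
  have eN : y N = x i + 1%:R * L.
    by rewrite /y -[X in order_stat L x X]add0n -[X in (0 + X)%N]mul1n order_statD// e0 mul0r addr0.
  by rewrite (yc e0) (yc eN) mul0n addn0 mul1n.
- by move=> j; congr (avoids _ f); apply/setP => i; rewrite !inE;
    apply: eq_existsb => l; rewrite -addSn addnAC modnDr.
move=> j; split => [/forallP av k l lr ck|H].
  have [i e] := order_stat_mem L x k N0.
  have /cells_afterP := av i; apply; exists l => //.
  by rewrite -ck (yc e) addnC modnMDl modn_small.
apply/forallP => i; apply/negP => /cells_afterP[l lr fi].
have [k e] := order_stat_surj L x i.
(* Advancing the index by [(j.+1 + l) %/ M] full periods moves the point from cell [f i] to cell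
   [j.+1 + l] of the unrolled line. *)
apply: (H (k + (j.+1 + l) %/ M * N)%N l lr).
by rewrite [RHS](divn_eq _ M) -fi [RHS]addnC; apply: yc; rewrite /y order_statD// e.
Qed.

(** For a cell gap [d], the positive parts of [d - r] and [d - r - 1] differ by 1 if [d > r] and by
    0 otherwise. *)
Let card_gaps r : (empty_arcs r f = empty_arcs r.+1 f +
  #|[set k : 'I_N | r < c k.+1 - c k]%SET|)%N.
Proof.
rewrite !empty_arcs_gaps -sum1_card [X in (_ + X)%N]big_mkcond -big_split/=.
by apply: eq_bigr => k _; rewrite inE; case: ltnP; lia.
Qed.

(** Neighbours whose cells are [d] apart have a spacing strictly between [(d - 1) * h] and
    [(d + 1) * h]. By the lower bound, [d > r] forces a spacing above [r * h]. *)
Lemma card_spacing_gt r t : t <= r%:R * h ->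
  (empty_arcs r f <= empty_arcs r.+1 f + #|[set i | (t < spacing L x i)%R]%SET|)%N.
Proof.
move=> tr; rewrite card_gaps leq_add2l; apply/subset_leq_card/fintype.subsetP => k.
rewrite !inE => rd; apply: le_lt_trans tr _; rewrite /spacing -/y.
have /andP[lo _] := y_cell k.+1; have /andP[_ up] := y_cell k.
have : (r + (c k).+1)%:R * h <= (c k.+1)%:R * h.
  by rewrite ler_pM2r// ler_nat; lia.
by rewrite natrD mulrDl; lra.
Qed.

(** By the upper bound [(d + 1) * h], a spacing of at least [(r + 1) * h] forces [d > r]. *)
Lemma card_spacing_ge r t : r.+1%:R * h <= t ->
  (empty_arcs r.+1 f + #|[set i | (t <= spacing L x i)%R]%SET| <= empty_arcs r f)%N.
Proof.
move=> tr; rewrite (card_gaps r) leq_add2l; apply/subset_leq_card/fintype.subsetP => k.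
rewrite !inE => /(le_trans tr); rewrite /spacing -/y => {}tr.
have /andP[_ up] := y_cell k.+1; have /andP[lo _] := y_cell k.
have : (r.+1 + c k)%:R * h < (c k.+1).+1%:R * h.
  by rewrite natrD mulrDl; lra.
by rewrite ltr_pM2r// ltr_nat; lia.
Qed.

End cells.

(** * Tails of the spacings *)

Lemma expRN_sub_le (R : realType) (a b : R) : 0 <= a <= b ->
  expR (- a) - expR (- b) <= b - a.
Proof.
move=> /andP[a0 ab].
have -> : - b = - a + - (b - a) by ring.
rewrite expRD; have := expR_ge1Dx (- (b - a)).
have : expR (- a) <= 1 by rewrite -[leRHS]expR0 ler_expR; lra.
have := expR_gt0 (- a).
move: (expR (- a)) (expR _) => u v u0 u1 v1.
by nra.
Qed.

(** Mean value bounds for [exp(-x)] on [[a, a + e]]; with [e = 1/m] they turn a difference of two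
    consecutive [W_r / M] into a tail value. *)
Lemma expRN_slope (R : realType) (a e : R) : 0 <= a -> 0 < e ->
  e * expR (- (a + e)) <= expR (- a) - expR (- (a + e)) <= e * expR (- a).
Proof.
move=> a0 e0; have -> : - (a + e) = - a + - e by ring.
rewrite expRD; have := expR_ge1Dx (- e); have := expR_ge1Dx e.
have := expR_gt0 (- a); have := expRxMexpNx_1 e; have := expR_gt0 (- e).
move: (expR (- a)) (expR (- e)) (expR e) => u v w v0 wv u0 w1 v1.
have k : v * (1 + e) <= v * w by rewrite ler_pM2l.
rewrite [v * w]mulrC wv in k.
have k1 : 0 <= u * (1 - v * (1 + e)) by rewrite mulr_ge0 ?(ltW u0)// subr_ge0.
have k2 : 0 <= u * (v - (1 - e)) by rewrite mulr_ge0 ?(ltW u0)// subr_ge0.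
by apply/andP; split; lra.
Qed.

Section tail.
Variables (R : realType) (L del : R) (N m rmax : nat) (x : 'I_N -> R).
Variable (f : {ffun 'I_N -> 'I_(N * m)}).
Hypothesis N0 : (0 < N)%N.
Hypothesis m0 : (0 < m)%N.
Hypothesis L0 : 0 < L.
Let h := L / (N * m)%:R.
Hypothesis xf : forall i, (f i)%:R * h <= x i < (f i).+1%:R * h.
Hypothesis Wf : forall r, (r <= rmax.+2)%N ->
  `|(empty_arcs r f)%:R / (N * m)%:R - expR (- (r%:R / m%:R))| <= del.

Let s := L / N%:R.
(** [2 / m] pays for rounding by two cells, in units of [L / N]; [2 * m * del] pays for the errors
    on two values [W_r / M], enlarged by [m]. *)
Let tol := 2 / m%:R + 2 * m%:R * del.

Let NR : 0 < N%:R :> R. Proof. by rewrite ltr0n. Qed.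
Let mR : 0 < m%:R :> R. Proof. by rewrite ltr0n. Qed.
Let h0 : 0 < h. Proof. by rewrite divr_gt0// ltr0n muln_gt0 N0. Qed.
Let s0 : 0 < s. Proof. by rewrite divr_gt0. Qed.
Let sh : s = m%:R * h.
Proof. by rewrite /s /h natrM; field; rewrite !gt_eqF. Qed.
Let Lh : L = (N * m)%:R * h.
Proof. by rewrite mulrC divfK// gt_eqF// ltr0n muln_gt0 N0. Qed.

(** As [M = N * m], dividing by [N] means dividing by [M] and multiplying by [m]. This factor
    cancels the [1/m] of [expRN_slope] and enlarges the two errors [del]. *)
Let dW r : (r <= rmax.+1)%N ->
  expR (- (r.+1%:R / m%:R)) - 2 * m%:R * del <=
    ((empty_arcs r f)%:R - (empty_arcs r.+1 f)%:R) / N%:R <=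
  expR (- (r%:R / m%:R)) + 2 * m%:R * del.
Proof.
move=> rr.
have /ler_normlP[a1 a2] := Wf (leqW rr).
have /ler_normlP[b1 b2] := Wf (r := r.+1) rr.
have mi : 0 < m%:R^-1 :> R by rewrite invr_gt0.
have := expRN_slope (a := r%:R / m%:R) (divr_ge0 (ler0n _ _) (ltW mR)) mi.
have -> : r%:R / m%:R + m%:R^-1 = r.+1%:R / m%:R :> R by rewrite -natr1 mulrDl mul1r.
move: a1 a2 b1 b2.
have -> (w : nat) : w%:R / (N * m)%:R = w%:R / N%:R / m%:R :> R.
  by rewrite natrM invfM mulrA.
have -> (w : nat) : w%:R / (N * m)%:R = w%:R / N%:R / m%:R :> R.
  by rewrite natrM invfM mulrA.
rewrite mulrBl.
move: ((empty_arcs r f)%:R / N%:R) ((empty_arcs r.+1 f)%:R / N%:R) => u v.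
move: (expR (- (r%:R / m%:R))) (expR (- (r.+1%:R / m%:R))) => p q a1 a2 b1 b2 /andP[c1 c2].
have k1 : m%:R * (m%:R^-1 * q) <= m%:R * (p - q) by rewrite ler_pM2l.
have k2 : m%:R * (p - q) <= m%:R * (m%:R^-1 * p) by rewrite ler_pM2l.
rewrite !mulVKf ?gt_eqF// in k1 k2.
have e1 : m%:R * (u / m%:R) = u by field; rewrite gt_eqF.
have e2 : m%:R * (v / m%:R) = v by field; rewrite gt_eqF.
have d1 : m%:R * ((p - u / m%:R) + (v / m%:R - q)) <= m%:R * (del + del).
  by rewrite ler_pM2l//; lra.
have d2 : m%:R * ((u / m%:R - p) + (q - v / m%:R)) <= m%:R * (del + del).
  by rewrite ler_pM2l//; lra.
move: d1 d2; by rewrite !mulrDr !mulrN e1 e2; lra.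
Qed.

Let del0 : 0 <= del. Proof. exact: le_trans (Wf (leq0n _)). Qed.

(** [X] is rounded to multiples of [1/m]. Strict and weak tails are both treated because the
    empirical distribution has atoms. *)
Lemma spacing_tails X : 0 <= X -> X * m%:R < rmax.+1%:R ->
  `|#|[set i : 'I_N | (X < spacing L x i / (L / N%:R))%R]%SET|%:R / N%:R - expR (- X)| <= tol /\
  `|#|[set i : 'I_N | (X <= spacing L x i / (L / N%:R))%R]%SET|%:R / N%:R - expR (- X)| <= tol.
Proof.
move=> X0 Xr; rewrite -/s; set A := #|_|; set C := #|_|.
have AC : A%:R / N%:R <= C%:R / N%:R :> R.
  rewrite ler_pM2r ?invr_gt0// ler_nat; apply/subset_leq_card/fintype.subsetP => i.
  by rewrite !inE => /ltW.
have Xm0 : 0 <= X * m%:R by rewrite mulr_ge0// ltW.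
set r := Num.truncn (X * m%:R).
have /andP[r1 r2] := truncn_itv Xm0; rewrite -/r in r1 r2.
have rr : (r <= rmax)%N by rewrite -ltnS -(ltr_nat R) (le_lt_trans r1).
have mi : 0 < m%:R^-1 :> R by rewrite invr_gt0.
(* [X * s] is at most [(r + 1) * h], so at least [W_(r+1) - W_(r+2)] spacings exceed it; this is why
   [Wf] reaches up to [rmax.+2]. *)
have lo : expR (- X) - tol <= A%:R / N%:R.
  have : X * s <= r.+1%:R * h by rewrite sh mulrA ler_pM2r// ltW.
  move=> /(card_spacing_gt N0 h0 Lh xf).
  have -> : [set i | X * s < spacing L x i]%SET = [set i | X < spacing L x i / s]%SET.
    by apply/setP => i; rewrite !inE ltr_pdivlMr.
  rewrite -/A -(ler_nat R) natrD => cA.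
  have /andP[+ _] := dW (r := r.+1) rr.
  have : ((empty_arcs r.+1 f)%:R - (empty_arcs r.+2 f)%:R) / N%:R <= A%:R / N%:R :> R.
    by rewrite ler_pM2r ?invr_gt0//; lra.
  have : X <= r.+2%:R / m%:R <= X + 2 / m%:R.
    rewrite ler_pdivlMr// ler_pdivrMr// mulrDl divfK ?gt_eqF// -addn2 natrD.
    by rewrite -natr1 in r2; apply/andP; split; lra.
  move=> /andP[x1 x2].
  have := @expRN_sub_le _ X (r.+2%:R / m%:R); rewrite X0 x1 => /(_ isT).
  by rewrite /tol; lra.
have up : C%:R / N%:R <= expR (- X) + tol.
  (* For [r = 0] there is no [W_(r-1)], but then [X <= 1/m] and the trivial bound 1 on the
     proportion suffices. *)
  have [r0|r0] := posnP r.
    have : C%:R / N%:R <= 1 :> R.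
      by rewrite ler_pdivrMr// mul1r ler_nat -[leqRHS]card_ord max_card.
    have : X <= 1 / m%:R by rewrite ler_pdivlMr// ltW//; move: r2; rewrite r0.
    have := expR_ge1Dx (- X).
    have : 0 <= m%:R * del by rewrite mulr_ge0// ltW.
    by rewrite /tol; lra.
  have : r.-1.+1%:R * h <= X * s by rewrite prednK// sh [X * _]mulrA ler_pM2r.
  move=> /(card_spacing_ge N0 h0 Lh xf).
  have -> : [set i | X * s <= spacing L x i]%SET = [set i | X <= spacing L x i / s]%SET.
    by apply/setP => i; rewrite !inE ler_pdivlMr.
  rewrite -/C -(ler_nat R) natrD => cC.
  have rr1 : (r.-1 <= rmax.+1)%N by rewrite (leq_trans (leq_pred _))// leqW.
  have /andP[_ +] := dW rr1.
  have : C%:R / N%:R <= ((empty_arcs r.-1 f)%:R - (empty_arcs r.-1.+1 f)%:R) / N%:R :> R.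
    by rewrite ler_pM2r ?invr_gt0//; lra.
  have : r.-1%:R / m%:R <= X <= r.-1%:R / m%:R + 2 / m%:R.
    rewrite ler_pdivrMr// -mulrDl ler_pdivlMr//.
    have e : r%:R = r.-1%:R + 1 :> R by rewrite natr1 prednK.
    by rewrite -natr1 in r2; apply/andP; split; lra.
  move=> /andP[x1 x2].
  have := @expRN_sub_le _ (r.-1%:R / m%:R) X; rewrite x1 divr_ge0// ?(ltW mR)// => /(_ isT).
  by rewrite /tol; lra.
by split; apply/ler_normlP; split; lra.
Qed.

End tail.

(** * Digits versus tails *)

(** A common real-valued interface for the empirical distribution of the spacings and the
    exponential law; finite additivity is enough to cut along finitely many intervals. *)
Definition additive_prob (R : realType) (mu : set R -> R) : Prop :=
  [/\ forall A C, measurable A -> measurable C -> A `&` C = set0 ->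
        mu (A `|` C) = mu A + mu C,
      forall A, 0 <= mu A &
      mu setT = 1].

Section additive_prob_theory.
Variables (R : realType) (mu : set R -> R).
Hypothesis mup : additive_prob mu.

Lemma additive_probD (A C : set R) : measurable A -> measurable C -> C `<=` A ->
  mu (A `\` C) = mu A - mu C.
Proof.
move=> mA mC CA; case: mup => muU _ _.
have /(congr1 mu) : (A `\` C) `|` C = A by rewrite setUC setDUK.
rewrite muU//; first by move=> <-; ring.
- exact: measurableD.
- by rewrite setDKI.
Qed.

Lemma additive_prob_le (A C : set R) : measurable A -> measurable C -> C `<=` A ->
  mu C <= mu A.
Proof.
by move=> mA mC CA; rewrite -subr_ge0 -additive_probD//; case: mup.
Qed.

End additive_prob_theory.

(** On the block from [B^a] to [B^(a+1)] the integer part of the logarithm is constantly [a], so a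
    bound on the digit cuts out an initial interval. *)
Lemma digit_log_le (R : realType) (B u t : R) (a : int) : 1 < B -> u < 1 ->
  expR (a%:~R * ln B) <= t < expR ((a + 1)%:~R * ln B) ->
  (digit_log B t <= u) = (t <= expR ((a%:~R + u) * ln B)).
Proof.
move=> B1 u1 /andP[lo up].
have lnB : 0 < ln B by rewrite ln_gt0.
have t0 : 0 < t by apply: lt_le_trans lo; exact: expR_gt0.
have fl : Num.floor (logB B t) = a.
  apply: floor_def; rewrite /logB ler_pdivlMr// ltr_pdivrMr//.
  by rewrite -ler_expR -ltr_expR lnK// lo.
rewrite /digit_log /mod1 fl lerBlDl /logB ler_pdivrMr//.
by rewrite -[t in RHS]lnK// ler_expR.
Qed.

Section digit_comparison.
Variables (R : realType) (B s u eta : R) (a : int) (K : nat).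
Variables (mu nu : set R -> R).
Hypothesis B1 : 1 < B.
Hypothesis s0 : 0 < s.
Hypothesis u01 : 0 <= u < 1.
Hypotheses (mup : additive_prob mu) (nup : additive_prob nu).

(** With [s] to become the mean spacing [L / N], these are [B^(a+k)] and [B^(a+k+u)] in units of
    [s]. *)
Let alpha (k : nat) := expR ((a + k%:Z)%:~R * ln B) / s.
Let beta (k : nat) := expR (((a + k%:Z)%:~R + u) * ln B) / s.

Hypothesis rays : forall x, 0 <= x <= alpha K ->
  `|mu `[x, +oo[ - nu `[x, +oo[| <= eta /\ `|mu `]x, +oo[ - nu `]x, +oo[| <= eta.

Variable D : set R.
Hypothesis mD : measurable D.
Hypothesis DE : forall t, 0 < t -> D t <-> digit_log B (t * s) <= u.

Let lnB : 0 < ln B. Proof. by rewrite ln_gt0. Qed.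
Let alpha_gt0 k : 0 < alpha k. Proof. by rewrite divr_gt0// expR_gt0. Qed.
Let alpha_homo k l : (k <= l)%N -> alpha k <= alpha l.
Proof.
by move=> kl; rewrite ler_pM2r ?invr_gt0// ler_expR ler_pM2r// ler_int lerD2l.
Qed.
Let alpha_le_beta k : alpha k <= beta k.
Proof.
rewrite ler_pM2r ?invr_gt0// ler_expR ler_pM2r//.
by have /andP[u0 _] := u01; rewrite lerDl.
Qed.
Let beta_lt_alpha k : beta k < alpha k.+1.
Proof.
rewrite ltr_pM2r ?invr_gt0// ltr_expR ltr_pM2r//.
have /andP[_ u1] := u01.
by rewrite -addn1 PoszD addrA [ltRHS]intrD ltrD2l.
Qed.

(* [alpha k, alpha k.+1[ holds the t with t * s in [B ^ (a + k), B ^ (a + k + 1)[. *)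
Let D_block k : D `&` `[alpha k, alpha k.+1[ = `[alpha k, +oo[ `\` `]beta k, +oo[.
Proof.
have /andP[_ u1] := u01.
apply/seteqP; split => t /=; rewrite !in_itv/= !andbT.
  move=> [Dt /andP[kt tk]]; split => //; apply/negP; rewrite -leNgt ler_pdivlMr//.
  rewrite -digit_log_le//; first by apply/DE => //; exact: lt_le_trans kt.
  rewrite ler_pdivrMr// in kt; rewrite ltr_pdivlMr// in tk.
  by rewrite kt -addrA -PoszD addn1.
move=> [kt /negP]; rewrite -leNgt => tb.
have tk : t < alpha k.+1 by apply: le_lt_trans tb _.
split; last by rewrite kt tk.
apply/DE; first exact: lt_le_trans kt.
rewrite (@digit_log_le _ _ _ _ (a + k%:Z))//; first by rewrite -ler_pdivlMr.
rewrite ler_pdivrMr// in kt; rewrite ltr_pdivlMr// in tk.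
by rewrite kt -addrA -PoszD addn1.
Qed.

(** Induction on blocks: by [D_block] each block contributes a difference of two rays, hence an
    error of at most [2 * eta]. *)
Let D_middle k : (k <= K)%N ->
  `|mu (D `&` `[alpha 0, alpha k[) - nu (D `&` `[alpha 0, alpha k[)| <= 2 * k%:R * eta.
Proof.
elim: k => [|k IH] kK.
  rewrite set_itvco0 setI0 mulr0 mul0r.
  have zero (m : set R -> R) : additive_prob m -> m set0 = 0.
    case=> mU _ _; have := mU set0 set0 measurable0 measurable0 (setI0 _).
    by rewrite setU0; lra.
  by rewrite !zero// subrr normr0.
have -> : D `&` `[alpha 0, alpha k.+1[ =
    (D `&` `[alpha 0, alpha k[) `|` (`[alpha k, +oo[ `\` `]beta k, +oo[).
  rewrite -D_block -setIUr; congr (_ `&` _); apply/seteqP; split => t /=;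
    rewrite !in_itv/=.
    by move=> /andP[-> tk]; case: (ltP t (alpha k)) => ?; [left|right; rewrite tk].
  case=> /andP[t1 t2]; rewrite ?t1 ?t2/=.
    by apply: lt_le_trans t2 _; exact: alpha_homo.
  by rewrite andbT (le_trans _ t1)// alpha_homo.
have sub : `]beta k, +oo[ `<=` `[alpha k, +oo[.
  move=> t /=; rewrite !in_itv/= !andbT => /ltW; apply: le_trans; exact: alpha_le_beta.
have disj : (D `&` `[alpha 0, alpha k[) `&` (`[alpha k, +oo[ `\` `]beta k, +oo[) = set0.
  apply/seteqP; split => // t /= [[_ +] [+ _]]; rewrite !in_itv/= andbT.
  by move=> /andP[_ +] /(lt_le_trans _) h => /h; rewrite ltxx.
have expand (m : set R -> R) : additive_prob m ->
    m ((D `&` `[alpha 0, alpha k[) `|` (`[alpha k, +oo[ `\` `]beta k, +oo[)) =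
    m (D `&` `[alpha 0, alpha k[) +
      (m `[alpha k, +oo[%classic - m `]beta k, +oo[%classic).
  move=> mp; have [mU _ _] := mp; rewrite mU ?additive_probD//.
  - exact: measurableI.
  - exact: measurableD.
rewrite !expand//.
have aK : 0 <= alpha k <= alpha K.
  by rewrite (ltW (alpha_gt0 _))/= alpha_homo// ltnW.
have bK : 0 <= beta k <= alpha K.
  rewrite (le_trans (ltW (alpha_gt0 k)))//=.
  by rewrite (le_trans (ltW (beta_lt_alpha _)))// alpha_homo.
have [/ler_normlP[p1 p2] _] := rays aK.
have [_ /ler_normlP[q1 q2]] := rays bK.
have /ler_normlP[r1 r2] := IH (ltnW kK).
by rewrite -natr1; apply/ler_normlP; split; lra.
Qed.

(** Outside the window, [D] is bounded by the mass of the two ends. Trading the end masses of [mu]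
    for those of [nu] costs one [eta] per end, whence [K.+1] in place of [K]. *)
Lemma digit_comparison :
  `|mu D - nu D| <= 2 * K.+1%:R * eta + (1 - nu `[alpha 0, +oo[) + nu `[alpha K, +oo[.
Proof.
have cut (m : set R -> R) : additive_prob m ->
    m (D `&` `[alpha 0, alpha K[) <= m D <=
    m (D `&` `[alpha 0, alpha K[) + (1 - m `[alpha 0, +oo[%classic) +
      m `[alpha K, +oo[%classic.
  move=> mp; have [mU m0 m1] := mp.
  have mDI : measurable (D `&` `[alpha 0, alpha K[) by exact: measurableI.
  apply/andP; split; first by apply: additive_prob_le => //; exact: subIsetl.
  have mC : measurable ([set: R] `\` `[alpha 0, +oo[) by exact: measurableD.
  rewrite -m1 -additive_probD//.
  have lowD : D `&` `[alpha 0, alpha K[ `&` ([set: R] `\` `[alpha 0, +oo[) = set0.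
    apply/seteqP; split => // t /= [[_ +] [_]]; rewrite !in_itv/= andbT.
    by move=> /andP[-> _].
  rewrite -mU//.
  have highD : (D `&` `[alpha 0, alpha K[ `|` ([set: R] `\` `[alpha 0, +oo[)) `&`
      `[alpha K, +oo[ = set0.
    apply/seteqP; split => // t /= [[[_ +]|[_ +]] +]; rewrite !in_itv/= !andbT.
      by move=> /andP[_ tK] /(lt_le_trans tK); rewrite ltxx.
    by move=> tn Kt; apply: tn; rewrite (le_trans _ Kt)// alpha_homo.
  rewrite -mU//; last by exact: measurableU.
  apply: additive_prob_le => //.
    by apply: measurableU => //; exact: measurableU.
  move=> t Dt /=; rewrite !in_itv/= !andbT.
  have [t0|t0] := leP (alpha 0) t; last by left; right; split => //; rewrite leNgt t0.
  by have [tK|tK] := ltP t (alpha K); [left; left|right].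
have /andP[m1 m2] := cut _ mup; have /andP[n1 n2] := cut _ nup.
have aK : 0 <= alpha K <= alpha K by rewrite (ltW (alpha_gt0 _)) lexx.
have a0 : 0 <= alpha 0 <= alpha K by rewrite (ltW (alpha_gt0 _)) alpha_homo.
have [/ler_normlP[p1 p2] _] := rays aK.
have [/ler_normlP[q1 q2] _] := rays a0.
have /ler_normlP[r1 r2] := D_middle (leqnn K).
have [_ nu0 _] := nup.
have [_ /(_ `[alpha K, +oo[%classic) nK _] := nup.
have : nu `[alpha 0, +oo[ <= 1.
  by have [_ _ <-] := nup; apply: additive_prob_le.
by rewrite -natr1 => n01; apply/ler_normlP; split; lra.
Qed.

End digit_comparison.

(** * The exponential distribution *)

(* The library's probability structure on exponential_prob takes a proof of
   0 < rate, so it cannot be inferred from the function alone. *)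
Lemma exponential_prob_is_prob (R : realType) (rate : R) : 0 < rate ->
  exists2 nu : probability (measurableTypeR R) R,
    (forall A, nu A = exponential_prob rate A) &
    forall A C : set R, measurable A -> measurable C -> A `&` C = set0 ->
      nu (A `|` C) = (nu A + nu C)%E.
Proof.
move=> r0.
exists (@exponential_distribution_exponential_prob__canonical__probability_measure_Probability R rate r0) => //.
by move=> A C mA mC AC; apply: measureU.
Qed.

(** The density vanishes on the negative half-line, and the point 0, where it does not vanish, is
    null. *)
Lemma exponential_prob_nonpos (R : realType) (A : set R) : measurable A ->
  A `<=` `]-oo, 0] -> exponential_prob 1 A = 0%E.
Proof.
move=> mA A0.
have [nu nuE nuU] := exponential_prob_is_prob (@ltr01 R).
apply/eqP; rewrite eq_le -nuE measure_ge0 andbT.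
apply: (@le_trans _ _ (nu (`]-oo, 0[ `|` [set 0]))).
  apply: le_measure; rewrite ?inE//; first by exact: measurableU.
  move=> t /A0 /=; rewrite !in_itv/= le_eqVlt => /orP[/eqP ->|]; [by right|by left].
rewrite nuU//; last first.
  apply/seteqP; split => // t /= [].
  by rewrite in_itv/= => + t0; rewrite t0 ltxx.
rewrite !nuE /exponential_prob integral_set1 adde0 integral0_eq// => t /=.
by rewrite in_itv/= => t0; rewrite lt0_exponential_pdf.
Qed.

Lemma exponential_prob_gt (R : realType) (x : R) : 0 <= x ->
  exponential_prob 1 `]x, +oo[ = (expR (- x))%:E.
Proof.
have [nu nuE nuU] := exponential_prob_is_prob (@ltr01 R).
have nuC (y : R) : nu `]y, +oo[%classic = (1 - nu `]-oo, y]%classic)%E.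
  rewrite -probability_setC//; congr (nu _).
  by apply/seteqP; split => t /=; rewrite !in_itv/= ?andbT ltNge => /negP.
rewrite le_eqVlt => /orP[/eqP <-|x0].
  by rewrite -nuE nuC nuE exponential_prob_nonpos// oppr0 expR0 sube0.
rewrite -nuE nuC.
have -> : `]-oo, x]%classic = `]-oo, 0[%classic `|` `[0, x]%classic :> set R.
  apply/seteqP; split => t /=; rewrite !in_itv/=.
    by move=> tx; case: (ltP t 0) => ?; [left|right].
  by case=> [/lt_trans/(_ x0)/ltW|/andP[]].
rewrite nuU//; last first.
  apply/seteqP; split => // t /= []; rewrite !in_itv/= => t0 /andP[+ _].
  by rewrite leNgt t0.
rewrite nuE exponential_prob_nonpos//; last first.
  by move=> t /=; rewrite !in_itv/= => /ltW.
rewrite add0e nuE exponential_prob_itv0c// mulN1r.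
have -> : (1 - (1 - (expR (- x))%:E))%E = (1 - (1 - expR (- x)))%:E by [].
by rewrite subKr.
Qed.

Lemma exponential_prob_ge (R : realType) (x : R) : 0 <= x ->
  exponential_prob 1 `[x, +oo[ = (expR (- x))%:E.
Proof.
move=> x0; have [nu nuE nuU] := exponential_prob_is_prob (@ltr01 R).
have -> : `[x, +oo[%classic = [set x] `|` `]x, +oo[%classic :> set R.
  apply/seteqP; split => t /=; rewrite !in_itv/= !andbT.
    by rewrite le_eqVlt => /orP[/eqP ->|]; [left|right].
  by case=> [->//|/ltW].
rewrite -nuE; rewrite nuU//; last first.
  apply/seteqP; split => // t /= [->].
  by rewrite in_itv/= ltxx.
by rewrite !nuE exponential_prob_gt// /exponential_prob integral_set1 add0e.
Qed.

(** * Measurability *)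

Section measurability.
Variables (d : measure_display) (T : measurableType d) (R : realType).

Lemma measurable_card (I : finType) (b : I -> T -> bool) :
  (forall i, measurable_fun setT (b i)) ->
  measurable_fun setT (fun w => #|[set i | b i w]%SET|%:R : R).
Proof.
move=> mb.
have -> : (fun w => #|[set i | b i w]%SET|%:R : R) =
    (fun w => \sum_(i <- enum I) if b i w then 1 else 0).
  apply/funext => w; rewrite -sum1_card natr_sum big_enum/= big_mkcond/=.
  by apply: eq_bigr => i _; rewrite inE.
apply: measurable_sum => i; apply: measurable_fun_ifT => //.
Qed.

(** The value at sorted position [k %% N] exceeds [y] exactly when at most [k %% N] of the [X i] are
    [<= y], and such counts are measurable. *)
Lemma measurable_order_stat (L : R) (N : nat) (X : 'I_N -> T -> R) (k : nat) :
  (0 < N)%N -> (forall i, measurable_fun setT (X i)) ->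
  measurable_fun setT (fun w => order_stat L (X^~ w) k).
Proof.
move=> N0 mX; apply: measurable_funD => //.
apply: (measurability _ (RGenOInfty.measurableE R)) => _ [_ [y ->] <-].
rewrite setTI.
have -> : (fun w => nth 0 (sort <=%R (codom (X^~ w))) (k %% N)) @^-1` `]y, +oo[ =
    [set w | #|[set i | X i w <= y]%SET|%:R <= (k %% N)%:R :> R].
  apply/seteqP; split => w /=; rewrite in_itv/= andbT ler_nat.
    set s := sort _ _ => ys; rewrite leqNgt; apply/negP => kc.
    have ss : sorted <=%O s by apply: sort_sorted; exact: le_total.
    have cs : count (<= y) s = #|[set i | X i w <= y]%SET|.
      rewrite /s (permP (permEl (perm_sort _ _))) codomE count_map cardE size_filter.
      by rewrite enumT; apply: eq_count => i; rewrite /= inE.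
    by have := @nth_count_le _ _ y 0 s (k %% N)%N ss; rewrite cs => /(_ kc); rewrite leNgt ys.
  set s := sort _ _ => kc.
  have ss : sorted <=%O s by apply: sort_sorted; exact: le_total.
  have cs : count (<= y) s = #|[set i | X i w <= y]%SET|.
    rewrite /s (permP (permEl (perm_sort _ _))) codomE count_map cardE size_filter.
    by rewrite enumT; apply: eq_count => i; rewrite /= inE.
  apply: (nth_count_gt 0 ss); rewrite cs kc/=.
  by rewrite /s size_sort size_codom card_ord ltn_mod.
rewrite -[X in measurable X]setTI; apply: measurable_fun_le => //.
by apply: measurable_card => i; apply: measurable_fun_ler.
Qed.

Lemma measurable_digit_log (B : R) : measurable_fun setT (digit_log B).
Proof.
have ml : measurable_fun setT (logB B) by apply: measurable_funM => //; exact: measurable_ln.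
apply: measurable_funB => //.
have mf : measurable_fun setT (fun x : R => (Num.floor x)%:~R : R).
  by apply: nondecreasing_measurable => // x y xy; rewrite ler_int le_floor.
exact: (measurableT_comp mf ml).
Qed.

Lemma measurable_digit_cdf_spacing (L B u : R) (N : nat) (X : 'I_N -> T -> R) :
  (0 < N)%N -> (forall i, measurable_fun setT (X i)) ->
  measurable_fun setT (fun w => digit_cdf B (spacing L (X^~ w)) u).
Proof.
move=> N0 mX; apply: measurable_funM => //.
apply: measurable_card => i; apply: measurable_fun_ler => //.
apply: measurableT_comp; first exact: measurable_digit_log.
by apply: measurable_funB; exact: measurable_order_stat.
Qed.

End measurability.

(** * Right-continuity, and the Kolmogorov distance seen at rational points *)

Lemma digit_cdf_itv (R : realType) (B u : R) (N : nat) (y : 'I_N -> R) :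
  0 <= digit_cdf B y u <= 1.
Proof.
rewrite /digit_cdf divr_ge0//=; have [->|N0] := eqVneq (N%:R : R) 0.
  by rewrite invr0 mulr0.
by rewrite ler_pdivrMr ?lt0r ?N0 ?ler0n// mul1r ler_nat -[leqRHS]card_ord max_card.
Qed.

(** Only finitely many comparisons are involved, and immediately to the right of [u] none of them
    changes. *)
Lemma digit_cdf_right_continuous (R : realType) (B : R) (N : nat) (y : 'I_N -> R) :
  right_continuous (digit_cdf B y).
Proof.
move=> u; apply: cvg_near_cst.
have : \forall v \near u^'+, forall i : 'I_N,
    (digit_log B (y i) <= v) = (digit_log B (y i) <= u).
  apply: filter_forall => i; have [le|lt] := leP (digit_log B (y i)) u.
    by near=> v; rewrite (le_trans le)// ltW//; near: v; exact: nbhs_right_gt.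
  near=> v; apply/negbTE; rewrite -ltNge; near: v; exact: nbhs_right_lt.
apply: filterS => v h; rewrite /digit_cdf; congr (_%:R / _).
by apply: eq_card => i; rewrite !inE h.
Unshelve. all: by end_near.
Qed.

Section shifted_exp.
Variables (R : realType) (B a : R).

Let measurable_shift : measurable_fun setT (fun t : R => mod1 (digit_log B t + a)).
Proof.
have mf : measurable_fun setT (fun x : R => (Num.floor x)%:~R : R).
  by apply: nondecreasing_measurable => // x y xy; rewrite ler_int le_floor.
have md : measurable_fun setT (fun t : R => digit_log B t + a).
  by apply: measurable_funD => //; exact: measurable_digit_log.
by apply: measurable_funB => //; exact: (measurableT_comp mf md).
Qed.

Lemma measurable_shift_le u : measurable [set t : R | mod1 (digit_log B t + a) <= u].
Proof. by rewrite -[X in measurable X]setTI; exact: measurable_fun_le. Qed.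

(** As the cdf of a random variable, the function inherits its bounds and its right-continuity. *)
Lemma shifted_exp_digit_cdfE : exists (nu : probability (measurableTypeR R) R)
  (Y : {RV nu >-> R}), forall u, cdf Y u = (shifted_exp_digit_cdf B a u)%:E.
Proof.
have [nu nuE _] := exponential_prob_is_prob (@ltr01 R).
have mY : measurable_fun [set: measurableTypeR R]
    (fun t : measurableTypeR R => mod1 (digit_log B t + a)) by exact: measurable_shift.
exists nu, (mfun_Sub (mem_set mY)) => u.
rewrite /shifted_exp_digit_cdf -nuE fineK ?fin_num_measure//; last exact: measurable_shift_le.
Qed.

Lemma shifted_exp_digit_cdf_itv u : 0 <= shifted_exp_digit_cdf B a u <= 1.
Proof.
have [nu [Y YE]] := shifted_exp_digit_cdfE.
by rewrite -!lee_fin -YE cdf_ge0 cdf_le1.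
Qed.

Lemma shifted_exp_digit_cdf_right_continuous :
  right_continuous (shifted_exp_digit_cdf B a).
Proof.
move=> u; have [nu [Y YE]] := shifted_exp_digit_cdfE.
have := @cdf_right_continuous _ _ _ nu Y u; rewrite YE => /fine_cvg.
by apply: cvg_trans; apply: near_eq_cvg; near=> v; rewrite /= YE.
Unshelve. all: by end_near.
Qed.

End shifted_exp.

Section kolmogorov.
Variables (R : realType) (F G : R -> R).
Hypothesis F01 : forall u, 0 <= F u <= 1.
Hypothesis G01 : forall u, 0 <= G u <= 1.

Let has_ub : has_ubound [set `|F u - G u| | u in `[0, 1[].
Proof.
exists 1 => _ [u _ <-]; have /andP[f0 f1] := F01 u; have /andP[g0 g1] := G01 u.
by apply/ler_normlP; split; lra.
Qed.

Let nonempty : [set `|F u - G u| | u in `[0, 1[] !=set0.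
Proof. by exists `|F 0 - G 0|, 0; rewrite //= in_itv/= lexx ltr01. Qed.

Lemma kolmogorov_dist01_le c : (forall u, 0 <= u < 1 -> `|F u - G u| <= c) ->
  kolmogorov_dist01 F G <= c.
Proof.
move=> h; apply: ge_sup => // _ [u /= u01 <-]; apply: h.
by rewrite in_itv in u01.
Qed.

(** By right-continuity, a point witnessing a distance above [c] can be moved slightly to the right
    onto a rational, which makes the event a countable union. *)
Lemma kolmogorov_dist01_gt c : right_continuous F -> right_continuous G ->
  c < kolmogorov_dist01 F G <->
  exists2 q : rat, 0 <= (ratr q : R) < 1 & c < `|F (ratr q) - G (ratr q)|.
Proof.
move=> Fc Gc; split => [|[q q01 cq]]; last first.
  by apply: lt_le_trans cq _; apply: ub_le_sup => //; exists (ratr q).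
move=> /sup_gt[//|y [u /=]]; rewrite in_itv/= => /andP[u0 u1] <- cu.
have FG : `|F v - G v| @[v --> u^'+] --> `|F u - G u| by apply: cvg_norm; apply: cvgB.
have : \forall v \near u^'+, c < `|F v - G v|.
  by apply: (cvgr_gt _ FG).
rewrite /at_right near_withinE => /nbhs_ballP[e /= e0 he].
have [q] : exists q : rat, ratr q \in `]u, (Num.min (u + e) 1)[.
  by apply: rat_in_itvoo; rewrite lt_min u1 andbT ltrDl.
rewrite in_itv/= lt_min => /and3P[uq qe q1]; exists q.
  by rewrite q1 (le_trans u0)// ltW.
apply: he => //=; rewrite /ball/= ltr_norml; apply/andP; split; lra.
Qed.

End kolmogorov.

Lemma measurable_kolmogorov_event (d : measure_display) (T : measurableType d)
    (R : realType) (L B a c : R) (N : nat) (X : 'I_N -> T -> R) :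
  (0 < N)%N -> (forall i, measurable_fun setT (X i)) ->
  measurable [set w | c < kolmogorov_dist01
    (digit_cdf B (spacing L (X^~ w))) (shifted_exp_digit_cdf B a)].
Proof.
move=> N0 mX; set G := shifted_exp_digit_cdf B a.
have -> : [set w | c < kolmogorov_dist01 (digit_cdf B (spacing L (X^~ w))) G] =
  \bigcup_(q : rat) (if 0 <= (ratr q : R) < 1 then
    [set w | c < `|digit_cdf B (spacing L (X^~ w)) (ratr q) - G (ratr q)|] else set0).
  have kd w := @kolmogorov_dist01_gt _ _ _ (fun u => digit_cdf_itv B u (spacing L (X^~ w)))
    (shifted_exp_digit_cdf_itv B a) c (@digit_cdf_right_continuous R B N _)
    (@shifted_exp_digit_cdf_right_continuous R B a).
  apply/seteqP; split => w /=.
    by move=> /kd[q q01 cq]; exists q => //; rewrite q01.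
  move=> [q _]; case: ifP => // q01 cq; apply/kd; by exists q.
apply: bigcupT_measurable_rat => q; case: ifP => // _.
rewrite -[X in measurable X]setCK; apply: measurableC.
rewrite -[X in measurable X]setTI.
have -> : ~` [set w | c < `|digit_cdf B (spacing L (X^~ w)) (ratr q) - G (ratr q)|] =
    [set w | `|digit_cdf B (spacing L (X^~ w)) (ratr q) - G (ratr q)| <= c].
  by apply/seteqP; split => w /=; rewrite leNgt => /negP.
apply: measurable_fun_le => //.
apply: measurableT_comp => //; apply: measurable_funB => //.
exact: measurable_digit_cdf_spacing.
Qed.

(** * Distance of the digit distributions *)

Lemma mod1Dint (R : realType) (x : R) (z : int) : mod1 (x + z%:~R) = mod1 x.
Proof.
suff fl : Num.floor (x + z%:~R) = Num.floor x + z by rewrite /mod1 fl intrD; ring.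
apply: floor_def; have /andP[m0 m1] := mod1_itv x; rewrite /mod1 in m0 m1.
by rewrite addrAC !intrD; apply/andP; split; lra.
Qed.

Lemma mod1_digit_logM (R : realType) (B s t : R) : 0 < s -> 0 < t ->
  mod1 (digit_log B t + mod1 (logB B s)) = digit_log B (t * s).
Proof.
move=> s0 t0; rewrite /digit_log [logB B (t * s)]/logB lnM// mulrDl -!/(logB B _).
rewrite -[RHS](mod1Dint _ (- (Num.floor (logB B t) + Num.floor (logB B s)))).
by congr mod1; rewrite /mod1 intrN intrD; ring.
Qed.

(** Multiplication by [s] translates the logarithm by [log_B s]. This may fail for nonpositive
    numbers, whose [digit_log] is 0 by convention, so both sides are first restricted to the
    positive half-line. *)
Lemma shifted_exp_digit_cdf_scale (R : realType) (B s u : R) : 0 < s ->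
  shifted_exp_digit_cdf B (mod1 (logB B s)) u =
  fine (exponential_prob 1 [set t | digit_log B (t * s) <= u]).
Proof.
move=> s0; have [nu nuE nuU] := exponential_prob_is_prob (@ltr01 R).
have pos (A : set R) : measurable A -> nu A = nu (A `&` `]0, +oo[).
  move=> mA; rewrite -[in LHS](setUIDK A `]0, +oo[%classic) nuU//; last 3 first.
  - exact: measurableI.
  - exact: measurableD.
  - by apply/seteqP; split => // t [[_ ?] [_]].
  rewrite [X in (_ + X)%E]nuE exponential_prob_nonpos ?adde0//; first exact: measurableD.
  by move=> t [_] /=; rewrite !in_itv/= andbT => /negP; rewrite -leNgt.
have mD : measurable [set t : R | digit_log B (t * s) <= u].
  rewrite -[X in measurable X]setTI; apply: measurable_fun_le => //.
  apply: measurableT_comp; first exact: measurable_digit_log.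
  exact: measurable_funM.
rewrite /shifted_exp_digit_cdf -!nuE; congr fine.
rewrite pos; last exact: measurable_shift_le.
rewrite [RHS]pos//; congr (nu _); apply/seteqP.
by split => t [] /= + t0; have t1 := t0; rewrite in_itv/= andbT in t1;
  rewrite mod1_digit_logM.
Qed.

Lemma additive_prob_exponential (R : realType) :
  additive_prob (fun A : set R => fine (exponential_prob 1 A)).
Proof.
have [nu nuE nuU] := exponential_prob_is_prob (@ltr01 R); split.
- move=> A C mA mC AC; rewrite -!nuE nuU// fineD//; exact: fin_num_measure.
- by move=> A; rewrite -nuE fine_ge0.
- by rewrite -nuE probability_setT.
Qed.

Lemma additive_prob_empirical (R : realType) (N : nat) (t : 'I_N -> R) : (0 < N)%N ->
  additive_prob (fun A : set R => #|[set i | t i \in A]%SET|%:R / N%:R).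
Proof.
move=> N0; split.
- move=> A C _ _ AC; rewrite -mulrDl -natrD; congr (_%:R / _).
  have -> : [set i | t i \in A `|` C]%SET = ([set i | t i \in A] :|: [set i | t i \in C])%SET.
    by apply/setP => i; rewrite !inE in_setU.
  rewrite cardsU [X in (_ - X)%N](_ : _ = 0%N) ?subn0//.
  apply/eqP; rewrite cards_eq0; apply/eqP/setP => i; rewrite !inE -in_setI AC.
  by rewrite in_set0.
- by move=> A; rewrite divr_ge0.
- have -> : [set i | t i \in (@setT R)]%SET = [set: 'I_N]%SET.
    by apply/setP => i; rewrite !inE in_setT.
  by rewrite cardsT card_ord divff// pnatr_eq0 -lt0n.
Qed.

Section deterministic.
Variables (R : realType) (B L del d0 : R) (N m n rmax : nat) (x : 'I_N -> R).
Variable (f : {ffun 'I_N -> 'I_(N * m)}).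
Hypothesis B1 : 1 < B.
Hypothesis L0 : 0 < L.
Hypothesis N0 : (0 < N)%N.
Hypothesis m0 : (0 < m)%N.
Hypothesis d0_gt0 : 0 < d0.
Hypothesis xf : forall i,
  (f i)%:R * (L / (N * m)%:R) <= x i < (f i).+1%:R * (L / (N * m)%:R).
Hypothesis Wf : forall r, (r <= rmax.+2)%N ->
  `|(empty_arcs r f)%:R / (N * m)%:R - expR (- (r%:R / m%:R))| <= del.
Hypothesis rmaxP : expR (n.+1%:R * ln B) * d0 * m%:R < rmax.+1%:R.

(** The window of [digit_comparison] has [n.+1] blocks and runs from at most [d0] to at least
    [B^n * d0]. The exponential law puts mass at most [d0] below it and at most [exp(-B^n * d0)]
    above it. *)
Lemma digit_dist_le :
  kolmogorov_dist01 (digit_cdf B (spacing L x))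
    (shifted_exp_digit_cdf B (mod1 (logB B (L / N%:R)))) <=
  2 * n.+2%:R * (2 / m%:R + 2 * m%:R * del) + d0 + expR (- (expR (n%:R * ln B) * d0)).
Proof.
have NR : 0 < N%:R :> R by rewrite ltr0n.
have mR : 0 < m%:R :> R by rewrite ltr0n.
have lnB : 0 < ln B by rewrite ln_gt0.
set s := L / N%:R; have s0 : 0 < s by rewrite divr_gt0.
apply: kolmogorov_dist01_le => u u01.
rewrite shifted_exp_digit_cdf_scale//; set D := [set t | _].
have mD : measurable D.
  rewrite -[X in measurable X]setTI; apply: measurable_fun_le => //.
  apply: measurableT_comp; first exact: measurable_digit_log.
  exact: measurable_funM.
pose mu (A : set R) : R := #|[set i | (spacing L x i / s) \in A]%SET|%:R / N%:R.
pose nu (A : set R) : R := fine (exponential_prob 1 A).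
have -> : digit_cdf B (spacing L x) u = mu D.
  rewrite /digit_cdf /mu; congr (_%:R / _); apply: eq_card => i; rewrite !inE.
  by apply/idP/idP => [h|/set_mem]; [apply/mem_set|]; rewrite /D/= divfK ?gt_eqF.
rewrite -/(nu D).
(* [B^a] is the largest integer power of [B] not above [d0 * s], so the window starts within a
   factor [B] below [d0]. *)
set a := Num.floor (logB B (d0 * s)).
have ds : 0 < d0 * s by rewrite mulr_gt0.
have lo : expR (a%:~R * ln B) <= d0 * s.
  by rewrite -[leRHS]lnK// ler_expR -ler_pdivlMr// floor_le.
have up : d0 * s <= expR ((a + 1)%:~R * ln B).
  by rewrite -[leLHS]lnK// ler_expR -ler_pdivrMr// ltW// floorD1_gt.
have al0 : expR ((a + 0%:Z)%:~R * ln B) / s <= d0 by rewrite addr0 ler_pdivrMr.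
have alK : expR ((a + n.+1%:Z)%:~R * ln B) / s <= expR (n.+1%:R * ln B) * d0.
  rewrite ler_pdivrMr// -mulrA intrD mulrDl expRD mulrC ler_pM2l//.
  exact: expR_gt0.
have alK' : expR (n%:R * ln B) * d0 <= expR ((a + n.+1%:Z)%:~R * ln B) / s.
  rewrite ler_pdivlMr// -mulrA -addn1 PoszD [n%:Z + _]addrC addrA intrD mulrDl.
  by rewrite expRD [leRHS]mulrC ler_pM2l// expR_gt0.
have nuge y : 0 <= y -> nu `[y, +oo[%classic = expR (- y).
  by move=> y0; rewrite /nu exponential_prob_ge.
have nugt y : 0 <= y -> nu `]y, +oo[%classic = expR (- y).
  by move=> y0; rewrite /nu exponential_prob_gt.
have muge y : mu `[y, +oo[%classic = #|[set i | (y <= spacing L x i / s)%R]%SET|%:R / N%:R.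
  rewrite /mu; congr (_%:R / _); apply: eq_card => i; rewrite !inE.
  by rewrite mem_setE in_itv/= andbT.
have mugt y : mu `]y, +oo[%classic = #|[set i | (y < spacing L x i / s)%R]%SET|%:R / N%:R.
  rewrite /mu; congr (_%:R / _); apply: eq_card => i; rewrite !inE.
  by rewrite mem_setE in_itv/= andbT.
have alg k : 0 <= expR ((a + k%:Z)%:~R * ln B) / s.
  by rewrite divr_ge0// ?expR_ge0// ltW.
have := @digit_comparison R B s u (2 / m%:R + 2 * m%:R * del) a n.+1 mu nu B1 s0 u01
  (additive_prob_empirical _ N0) (additive_prob_exponential R).
move=> /(_ _ D mD (fun t _ => iff_refl _)); rewrite !nuge//.
move=> H; apply: le_trans (H _) _.
  move=> y /andP[y0 yK]; rewrite nuge// nugt// muge mugt.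
  have yr : y * m%:R < rmax.+1%:R.
    apply: le_lt_trans rmaxP; rewrite ler_pM2r//; exact: le_trans alK.
  by have [h1 h2] := spacing_tails N0 m0 L0 xf Wf y0 yr; split.
have := expR_ge1Dx (- (expR ((a + 0%:Z)%:~R * ln B) / s)).
have : expR (- (expR ((a + n.+1%:Z)%:~R * ln B) / s)) <= expR (- (expR (n%:R * ln B) * d0)).
  by rewrite ler_expR lerN2.
by move: al0; lra.
Qed.

End deterministic.

(** * Probability of the exceptional set *)

Lemma bernoulli_le (R : realFieldType) (w : R) (n : nat) : 0 <= w <= 1 ->
  1 - n%:R * w <= (1 - w) ^+ n.
Proof.
move=> /andP[w0 w1]; elim: n => [|n IH]; first by rewrite mul0r subr0 expr0.
rewrite exprS -natr1.
have : (1 - w) * (1 - n%:R * w) <= (1 - w) * (1 - w) ^+ n.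
  by rewrite ler_wpM2l// subr_ge0.
have : 0 <= n%:R * w * w by rewrite !mulr_ge0.
by lra.
Qed.

(* With z = y / n: e^-z (1 - z^2) <= 1 - z <= e^-z. *)
Lemma expRN_approx (R : realType) (y : R) (n : nat) : (0 < n)%N -> 0 <= y <= n%:R ->
  `|(1 - y / n%:R) ^+ n - expR (- y)| <= y ^+ 2 / n%:R.
Proof.
move=> n0 /andP[y0 yn]; have nR : 0 < n%:R :> R by rewrite ltr0n.
set z := y / n%:R.
have z0 : 0 <= z by rewrite divr_ge0.
have z1 : z <= 1 by rewrite ler_pdivrMr// mul1r.
have ey : expR (- y) = expR (- z) ^+ n.
  by rewrite -expRM_natl mulrN /z mulrC divfK ?gt_eqF.
have up : 1 - z <= expR (- z) by exact: expR_ge1Dx.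
have lo : expR (- z) * (1 - z ^+ 2) <= 1 - z.
  have k : expR (- z) * (1 + z) <= 1.
    by rewrite -[leRHS](expRxMexpNx_1 z) mulrC ler_pM2r ?expR_gt0// expR_ge1Dx.
  have := ler_wpM2r (_ : 0 <= 1 - z) k; rewrite subr_ge0 => /(_ z1).
  by rewrite mul1r; lra.
have zz : 0 <= z ^+ 2 <= 1 by rewrite sqr_ge0 expr_le1.
have UP : (1 - z) ^+ n <= expR (- y).
  by rewrite ey; apply: lerXn2r; rewrite ?nnegrE ?subr_ge0 ?expR_ge0.
have LO : expR (- y) * (1 - z ^+ 2) ^+ n <= (1 - z) ^+ n.
  have /andP[_ zz1] := zz.
  by rewrite ey -exprMn; apply: lerXn2r; rewrite ?nnegrE ?mulr_ge0 ?subr_ge0 ?expR_ge0.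
(* Bernoulli's inequality bounds the lost factor [(1 - z^2)^n] below by [1 - y^2 / n]. *)
have := bernoulli_le n zz.
have -> : n%:R * z ^+ 2 = y ^+ 2 / n%:R by rewrite /z; field; rewrite gt_eqF.
have e1 : expR (- y) <= 1 by rewrite -[leRHS]expR0 ler_expR oppr_le0.
have e0 := expR_gt0 (- y).
have q0 : 0 <= y ^+ 2 / n%:R by rewrite divr_ge0// sqr_ge0.
move: UP LO e0 e1 q0; move: (expR _) (_ ^+ n) (y ^+ 2 / _) ((1 - z) ^+ n) => E p q r.
move=> UP LO e0 e1 q0 b; have : E * (1 - q) <= E * p by rewrite ler_pM2l.
have : E * q <= q by rewrite ler_piMl.
by move=> *; apply/ler_normlP; split; lra.
Qed.

Lemma uniform_prob_co (R : realType) (L a b : R) (L0 : 0 < L) :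
  0 <= a <= b -> b <= L -> uniform_prob L0 `[a, b[ = ((b - a) / L)%:E.
Proof.
move=> /andP[a0 ab] bL; rewrite /uniform_prob.
under eq_integral => t /[!inE]/=.
  rewrite in_itv/= => /andP[at_ tb].
  rewrite /uniform_pdf (le_trans a0 at_) (ltW (lt_le_trans tb bL))/=.
  over.
rewrite integral_cst//= lebesgue_measure_itv/= lte_fin subr0.
have [lt|le] := ltP a b; first by rewrite -EFinB -EFinM mulrC.
have -> : b = a by apply/eqP; rewrite eq_le le ab.
by rewrite subrr mul0r mule0.
Qed.

Lemma measure_bigsetU_seq (d : measure_display) (T : measurableType d) (R : realType)
    (P : probability T R) (I : eqType) (E : I -> set T) (s : seq I) :
  uniq s -> (forall i, measurable (E i)) ->
  (forall i j, i != j -> E i `&` E j = set0) ->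
  P (\big[setU/set0]_(i <- s) E i) = (\sum_(i <- s) P (E i))%E.
Proof.
move=> us mE dE; elim: s us => [|i s IH] /=; first by rewrite !big_nil measure0.
move=> /andP[is_ us]; rewrite !big_cons measureU//.
- by congr (_ + _)%E; exact: IH.
- by apply: bigsetU_measurable.
- rewrite big_distrr/= big1_seq// => j /andP[_ js]; apply: dE.
  by apply: contraNneq is_ => ->.
Qed.

Section cell_probability.
Variables (d : measure_display) (T : measurableType d) (R : realType).
Variables (P : probability T R) (L : R) (L0 : 0 < L) (N M : nat).
Variable (X : 'I_N -> {RV P >-> R}).
Hypothesis M0 : (0 < M)%N.
Hypothesis indep : mutually_independent X.
Hypothesis unif : forall i, uniformly_distributed L0 (X i).

Let h := L / M%:R.
Let cell (c : 'I_M) : set R := `[c%:R * h, c.+1%:R * h[%classic.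

Definition cell_event (f : {ffun 'I_N -> 'I_M}) : set T :=
  [set w | forall i, (f i)%:R * h <= X i w < (f i).+1%:R * h].

Let MR : 0 < M%:R :> R. Proof. by rewrite ltr0n. Qed.
Let h0 : 0 < h. Proof. by rewrite divr_gt0. Qed.

Let cell_eventE f : cell_event f =
  \bigcap_(i in [set` [set: 'I_N]%SET]) (X i @^-1` cell (f i)).
Proof.
apply/seteqP; split => [w wf i _|w wf i].
  by rewrite /cell /= in_itv/=; exact: wf.
by have := wf i; rewrite /cell /= in_itv/= inE; apply.
Qed.

Let measurable_cell_event f : measurable (cell_event f).
Proof.
rewrite cell_eventE; apply: fin_bigcap_measurable => // i _.
by rewrite -[X in measurable X]setTI; apply: (measurable_funP (X i)) => //; exact: measurable_itv.
Qed.

(** Independence multiplies [N] uniform cell probabilities [1/M], so all assignments are equally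
    likely. *)
Let prob_cell_event f : P (cell_event f) = ((M ^ N)%:R^-1)%:E.
Proof.
rewrite cell_eventE.
have /(_ [set: 'I_N]%SET (fun i => cell (f i)) (fun i => measurable_itv _)) -> := indep.
transitivity (\prod_(i in [set: 'I_N]%SET) (M%:R^-1)%:E : \bar R)%E.
  apply: eq_bigr => i _; transitivity (distribution P (X i) (cell (f i))) => //.
  rewrite unif ?uniform_prob_co//; last exact: measurable_itv.
  - by congr EFin; rewrite /h -natr1; field; rewrite !gt_eqF.
  - by rewrite mulr_ge0 ?(ltW h0)//= ler_pM2r// ler_nat.
  - by rewrite /h mulrCA ger_pMr// ler_pdivrMr// mul1r ler_nat.
rewrite prodEFin; congr EFin.
by rewrite prodr_const cardsT card_ord natrX exprVn.
Qed.

(** The bound goes through the complement: the cell events of the [f] outside [Q] are disjoint from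
    each other and from [Ev], with total mass [1 - #|Q| / M^N]. The cell events need not cover the
    space; the half-open cells miss the value [L]. *)
Lemma prob_le_card (Ev : set T) (Q : {set {ffun 'I_N -> 'I_M}}) : measurable Ev ->
  (forall f w, f \notin Q -> cell_event f w -> ~ Ev w) ->
  (P Ev <= (#|Q|%:R / (M ^ N)%:R)%:E)%E.
Proof.
move=> mEv EvQ; set U := \big[setU/set0]_(f <- enum (~: Q)%SET) cell_event f.
have mU : measurable U by exact: bigsetU_measurable.
have PU : P U = (1 - #|Q|%:R / (M ^ N)%:R)%:E.
  rewrite /U measure_bigsetU_seq ?enum_uniq//; last first.
    move=> f g fg; apply/seteqP; split => // w [wf wg].
    move/eqP: fg; apply; apply/ffunP => i; apply: val_inj => /=.
    have /andP[f1 f2] := wf i; have /andP[g1 g2] := wg i.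
    have := le_lt_trans f1 g2; have := le_lt_trans g1 f2.
    by rewrite !ltr_pM2r// !ltr_nat !ltnS => a b; apply/eqP; rewrite eqn_leq a b.
  under eq_bigr do rewrite prob_cell_event.
  rewrite sumEFin big_const_seq count_predT -cardE iter_addr_0.
  rewrite (cardsCs (~: Q)%SET) finset.setCK card_ffun !card_ord.
  congr EFin; rewrite -[LHS]mulr_natl natrB ?mulrBl ?divff//.
    by rewrite pnatr_eq0 -lt0n expn_gt0 M0.
  by rewrite -[leqRHS](_ : #|{ffun 'I_N -> 'I_M}| = _) ?max_card// card_ffun !card_ord.
have EvU : Ev `&` U = set0.
  apply/seteqP; split => // w [Evw]; rewrite /U -bigcup_seq => -[f /=].
  by rewrite mem_enum inE => fQ /(EvQ _ _ fQ).
have : (P Ev + P U <= 1)%E.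
  by rewrite -measureU//; apply: probability_le1; exact: measurableU.
rewrite PU -[P Ev]fineK ?fin_num_measure// -EFinD !lee_fin; lra.
Qed.

End cell_probability.

(** A union bound over [r]. Half of [del] goes to Chebyshev's inequality, half to replacing
    [(1 - r/M)^N] by [exp(-r/m)]. In the cube, two factors bound [r ^ 2] and one counts the values
    of [r]. *)
Lemma card_bad_cells (R : realType) (N m rmax : nat) (del : R) :
  (0 < m)%N -> (rmax < N)%N -> 0 < del ->
  (rmax%:R / m%:R) ^+ 2 / N%:R <= del / 2 ->
  #|[set f : {ffun 'I_N -> 'I_(N * m)} | [exists r : 'I_rmax.+1,
      del < `|(empty_arcs r f)%:R / (N * m)%:R - expR (- (r%:R / m%:R))|]]%SET|%:R
    / ((N * m) ^ N)%:R <=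
  rmax.+1%:R ^+ 3 / (m%:R * (del / 2) ^+ 2) / N%:R.
Proof.
move=> m0 rN del0 small.
have N0 : (0 < N)%N by apply: leq_ltn_trans rN.
have NR : 0 < N%:R :> R by rewrite ltr0n.
have mR : 0 < m%:R :> R by rewrite ltr0n.
have M0 : (0 < N * m)%N by rewrite muln_gt0 N0.
have MR : 0 < (N * m)%:R :> R by rewrite ltr0n.
have del2 : 0 < del / 2 by rewrite divr_gt0.
set Q := finset _.
pose A (r : nat) := [set f : {ffun 'I_N -> 'I_(N * m)} | del / 2 <
  `|(empty_arcs r f)%:R / (N * m)%:R - ((N * m - r)%:R / (N * m)%:R) ^+ N|]%SET.
have QA : (#|Q| <= \sum_(r < rmax.+1) #|A r|)%N.
  under eq_bigr do rewrite -sum1_card big_mkcond.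
  rewrite exchange_big -sum1_card big_mkcond/=; apply: leq_sum => f _.
  case: ifP => //; rewrite inE => /existsP[r fr].
  rewrite (bigD1 r)//= inE ifT ?leq_addr//.
  have rle : (r <= rmax)%N by rewrite -ltnS.
  have rm0 : 0 <= r%:R / m%:R :> R by rewrite divr_ge0.
  have e : (N * m - r)%:R / (N * m)%:R = 1 - r%:R / m%:R / N%:R :> R.
    rewrite natrB; first by rewrite natrM; field; rewrite !gt_eqF.
    by rewrite (leq_trans rle)// (leq_trans (ltnW rN))// leq_pmulr.
  have rmN : 0 <= (r%:R / m%:R : R) <= N%:R.
    rewrite rm0 ler_pdivrMr// -natrM ler_nat (leq_trans rle)//.
    by rewrite (leq_trans (ltnW rN))// leq_pmulr.
  have := expRN_approx N0 rmN; rewrite -e.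
  have : (r%:R / m%:R) ^+ 2 / N%:R <= (rmax%:R / m%:R) ^+ 2 / N%:R :> R.
    rewrite ler_pM2r ?invr_gt0//; apply: lerXn2r; rewrite ?nnegrE ?divr_ge0//.
    by rewrite ler_pM2r ?invr_gt0// ler_nat.
  move: fr; move: (_ / (N * m)%:R) (_ ^+ N) (expR _) => w p E h1 h2 h3.
  rewrite ltNge; apply/negP => h4.
  have := ler_normD (w - p) (p - E); rewrite addrA subrK; lra.
have MN : 0 < ((N * m) ^ N)%:R :> R by rewrite ltr0n expn_gt0 M0.
apply: le_trans (_ : (\sum_(r < rmax.+1) #|A r|%:R) / ((N * m) ^ N)%:R <= _).
  by rewrite ler_pM2r ?invr_gt0// -natr_sum ler_nat.
rewrite mulr_suml.
apply: le_trans (_ : \sum_(r < rmax.+1) rmax.+1%:R ^+ 2 / ((N * m)%:R * (del / 2) ^+ 2) <= _).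
  apply: ler_sum => r _; have rle : (r <= rmax)%N by rewrite -ltnS.
  have rM : (r <= N * m)%N by rewrite (leq_trans rle)// (leq_trans (ltnW rN))// leq_pmulr.
  apply: le_trans (empty_arcs_chebyshev _ M0 rM del2) _.
  rewrite ler_pM2r; last by rewrite invr_gt0 mulr_gt0// exprn_gt0.
  by rewrite -natrX ler_nat leq_exp2r// ltnW.
rewrite sumr_const card_ord -[leLHS]mulr_natl natrM exprS.
rewrite le_eqVlt; apply/orP; left; apply/eqP; field.
by rewrite !gt_eqF.
Qed.

(** [C] and [N1] are chosen before the probability space, because in the limit statement the space
    varies with [N]. *)
Lemma event_prob_le (R : realType) (B L eps : R) (hL : 0 < L) : 1 < B -> 0 < eps ->
  exists (C : R) (N1 : nat), forall (d : measure_display) (T : measurableType d)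
    (P : probability T R) (N : nat) (X : 'I_N -> {RV P >-> R}),
  (N1 < N)%N -> mutually_independent X ->
  (forall i, uniformly_distributed hL (X i)) ->
  (P [set w | (eps < kolmogorov_dist01 (digit_cdf B (spacing L (fun i => X i w)))
      (shifted_exp_digit_cdf B (mod1 (logB B (L / N%:R)))))%R] <= (C / N%:R)%:E)%E.
Proof.
move=> B1 eps0.
have lnB : 0 < ln B by rewrite ln_gt0.
(* Three errors of at most [eps / 4] each are aimed at: the mass below the window (via [d0]), the
   mass above it (via [n]), and the discrepancy of the rays (via [eta]). *)
pose d0 : R := eps / 4; have d0_gt0 : 0 < d0 by rewrite divr_gt0.
(* Since [B^n >= n * ln B], this [n] gives [B^n * d0 >= 4 / eps]. *)
pose n := (Num.truncn (4 / eps / (ln B * d0))).+1.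
(* Chosen so that [2 * n.+2 * eta = eps / 4]; [m] and [del] then keep the two terms of the tolerance
   at most [eta / 2] each. *)
pose eta : R := eps / (8 * n.+2%:R).
have eta0 : 0 < eta by rewrite divr_gt0// mulr_gt0.
pose m := (Num.truncn (4 / eta)).+1.
have mR : 0 < m%:R :> R by rewrite ltr0n.
pose del : R := eta / (4 * m%:R).
have del0 : 0 < del by rewrite divr_gt0// mulr_gt0.
pose rmax := Num.truncn (expR (n.+1%:R * ln B) * d0 * m%:R).
pose C : R := rmax.+3%:R ^+ 3 / (m%:R * (del / 2) ^+ 2).
(* The first summand puts every [r <= rmax.+2] below [N]; the second makes the error of the
   exponential approximation at most [del / 2]. *)
pose N1 := (rmax.+2 + Num.truncn ((rmax.+2%:R / m%:R) ^+ 2 / (del / 2)))%N.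
exists C, N1 => d T P N X N1N indep unif.
have N0 : (0 < N)%N by apply: leq_ltn_trans N1N.
have NR : 0 < N%:R :> R by rewrite ltr0n.
have M0 : (0 < N * m)%N by rewrite muln_gt0 N0.
set Q := [set f : {ffun 'I_N -> 'I_(N * m)} | [exists r : 'I_rmax.+3,
      del < `|(empty_arcs r f)%:R / (N * m)%:R - expR (- (r%:R / m%:R))|]]%SET.
have bigN : (rmax.+2%:R / m%:R) ^+ 2 / N%:R <= del / 2.
  have del2 : 0 < del / 2 by rewrite divr_gt0.
  rewrite ler_pdivrMr// [leRHS]mulrC -ler_pdivrMr//.
  apply: ltW; apply: lt_le_trans (truncnS_gt _) _.
  by rewrite ler_nat; apply: leq_ltn_trans N1N; exact: leq_addl.
apply: (@le_trans _ _ (#|Q|%:R / ((N * m) ^ N)%:R)%:E); last first.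
  rewrite lee_fin; apply: card_bad_cells => //.
  by apply: leq_ltn_trans N1N; exact: leq_addr.
apply: (prob_le_card M0 indep unif).
  by apply: (@measurable_kolmogorov_event _ _ _ _ _ _ _ _ (fun i => X i : T -> R)).
move=> f w; rewrite inE negb_exists => /forallP fQ wf; apply/negP; rewrite -leNgt.
have Wf r : (r <= rmax.+2)%N ->
    `|(empty_arcs r f)%:R / (N * m)%:R - expR (- (r%:R / m%:R))| <= del.
  by move=> rr; have := fQ (Ordinal (rr : (r < rmax.+3)%N)); rewrite -leNgt.
have rmaxP : expR (n.+1%:R * ln B) * d0 * m%:R < rmax.+1%:R by exact: truncnS_gt.
apply: le_trans (digit_dist_le B1 hL N0 (ltn0Sn _) d0_gt0 wf Wf rmaxP) _.
have tol : 2 / m%:R + 2 * m%:R * del <= eta.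
  have -> : 2 * m%:R * del = eta / 2 by rewrite /del; field; rewrite gt_eqF.
  have : 2 / m%:R <= eta / 2.
    rewrite ler_pdivrMr//.
    have : 4 / eta < m%:R by exact: truncnS_gt.
    by rewrite ltr_pdivrMr// => h; lra.
  by lra.
have t1 : 2 * n.+2%:R * (2 / m%:R + 2 * m%:R * del) <= eps / 4.
  apply: le_trans (_ : 2 * n.+2%:R * eta <= _); first by rewrite ler_pM2l// mulr_gt0.
  rewrite le_eqVlt; apply/orP; left; apply/eqP; rewrite /eta; field.
  by rewrite gt_eqF.
set y := expR (n%:R * ln B) * d0.
have y4 : 4 / eps <= y.
  have : 4 / eps / (ln B * d0) <= n%:R by rewrite ltW// truncnS_gt.
  rewrite ler_pdivrMr ?mulr_gt0// mulrA => /le_trans; apply.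
  by rewrite ler_pM2r// (le_trans _ (expR_ge1Dx _))// lerDr.
(* From [exp(-y) <= 1 / y] and [y >= 4 / eps]. *)
have t2 : expR (- y) <= eps / 4.
  have e0 := expR_gt0 (- y).
  have : expR (- y) * y <= 1.
    rewrite -[leRHS](expRxMexpNx_1 y) mulrC ler_pM2r//.
    by rewrite (le_trans _ (expR_ge1Dx _))// lerDr.
  have : expR (- y) * (4 / eps) <= expR (- y) * y by rewrite ler_pM2l.
  by move=> a b; rewrite ler_pdivlMr// -[leRHS]mul1r -ler_pdivrMr// -mulrA; exact: le_trans a b.
apply: le_trans (lerD (lerD t1 (lexx d0)) t2) _; rewrite /d0; lra.
Qed.

Unset Implicit Arguments.
Set Strict Implicit.

Theorem theorem1p3 (R : realType) (B L : R) (hB : 1 < B) (hL : 0 < L)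
    (d : nat -> measure_display) (T : forall N : nat, measurableType (d N))
    (P : forall N : nat, probability (T N) R)
    (X : forall N : nat, 'I_N -> {RV (P N) >-> R})
    (indep : forall N : nat, mutually_independent (X N))
    (unif : forall (N : nat) (i : 'I_N), uniformly_distributed hL (X N i))
    (eps : R) (heps : 0 < eps) :
  P N [set w | eps < kolmogorov_dist01
                       (digit_cdf B (spacing L (fun i => X N i w)))
                       (shifted_exp_digit_cdf B (mod1 (logB B (L / N%:R))))]
    @[N --> \oo] --> 0%E.
Proof.
have [C [N1 PC]] := event_prob_le hL hB heps.
apply: (@squeeze_cvge _ _ _ _ (cst 0%E) _ (fun N => (C / N%:R)%:E)).
- near=> N; rewrite measure_ge0/=; apply: PC => //.
  by near: N; exact: nbhs_infty_gt.
- exact: cvg_cst.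
apply: cvg_EFin; first by near=> N.
rewrite -[X in _ --> X](mulr0 C); apply: cvgM; first exact: cvg_cst.
apply/gtr0_cvgV0; last exact: cvgr_idn.
by near=> N; rewrite ltr0n; near: N; exact: nbhs_infty_gt.
Unshelve. all: by end_near.
Qed.
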